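(* Let $\varphi\in\mathbb{R}[x]$ be a univariate real polynomial of degree at least $3$, and let $$f(x,y,z)=(x-y)^2+(\varphi(x)-z)^2 .$$ Then, for every $\varepsilon>0$ and any finite sets $A,B,C\subset\mathbb{R}$, each of size $n$, we have $$|f(A,B,C)|=\Omega\left(n^{5/3-\varepsilon}\right),$$ where the constant of proportionality depends only on $\deg\varphi$ and on $\varepsilon$. That is, for every integer $d\ge 3$ and every $\varepsilon>0$ there is a constant $c=c(d,\varepsilon)>0$ such that $|f(A,B,C)|\ge c\,n^{5/3-\varepsilon}$ for every $\varphi\in\mathbb{R}[x]$ of degree $d$, every positive integer $n$, and all $A,B,C\subset\mathbb{R}$ with $|A|=|B|=|C|=n$.
   Context: For $f\in\mathbb{R}[x,y,z]$ and finite sets $A,B,C\subset\mathbb{R}$, $f(A,B,C)=\{f(a,b,c)\mid a\in A,\ b\in B,\ c\in C\}$ denotes the image set, and $|\cdot|$ denotes cardinality. *)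

(* Defs.v *)
From mathcomp Require Export all_boot all_order all_algebra finmap.
From mathcomp Require Export reals exp.

Set Implicit Arguments.
Unset Strict Implicit.
Unset Printing Implicit Defensive.

Import GRing.Theory.

Local Open Scope ring_scope.
Local Open Scope fset_scope.

Definition image3 (T U : choiceType) (f : T -> T -> T -> U)
    (A B C : {fset T}) : {fset U} :=
  [fset f p.1.1 p.1.2 p.2 | p in (A `*` B) `*` C].

Lemma image3P (T U : choiceType) (f : T -> T -> T -> U)
    (A B C : {fset T}) (u : U) :
  reflect (exists a b c, [/\ a \in A, b \in B, c \in C & u = f a b c])
          (u \in image3 f A B C).
Proof.
apply: (iffP (imfsetP _ _ _ _)) => [[[[a b] c]] /=|[a [b [c [aA bB cC ->]]]]].
  rewrite !inE /= => /andP[/andP[aA bB] cC] ->.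
  by exists a, b, c.
by exists ((a, b), c); rewrite //= !inE /= aA bB cC.
Qed.

Definition sqdist_poly (R : nzRingType) (phi : {poly R}) (x y z : R) : R :=
  (x - y) ^+ 2 + (phi.[x] - z) ^+ 2.

(* Main.v *)
Require Import Defs.
From mathcomp Require Import all_boot all_order all_algebra finmap.
From mathcomp Require Import reals exp.
From mathcomp Require Import zify ring lra.

(** Write N for the number of values of f on A x B x C.  The proof gives
    n^5 <= K * N^3 * (1 + log n)^2 with K depending on deg phi only, by an elementary
    argument that uses the order of the reals twice.

    Near cocircular pairs.  For fixed a, the n^2 points of the grid B x C lie on at
    most N circles centred at (a, phi a).  On a quarter of such a circle the two
    coordinates are monotone, so a walk along it advances at most n steps in B and
    at most n steps in C; hence all but O(n/D + 1) of its grid points are followed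
    by another one that is at most D steps away in both coordinates.  With D a
    large multiple of N/n this yields at least (n^3)/2 triples made of some a and
    of two points (b,c), (b',c') that are D-close and at the same distance from
    (a, phi a) ([card_grid_le]); only N < n^2/16 matters here, as the inequality is
    clear for larger N.

    Collisions of lines.  Such a triple satisfies
      (b' - a)^2 - (b - a)^2 = (c - phi a)^2 - (c' - phi a)^2.
    The left side is an affine function of a, one for each close pair (b,b'), and
    the right side is an affine function of phi a, one for each close pair (c',c).
    By the inequality between arithmetic and geometric means, the number of
    triples is at most the mean of the numbers of coincidences within the two
    families, over the abscissas a, respectively phi a; the fibres of phi have at most
    deg phi elements, so the second family costs only a factor deg phi
    ([sum_near_cocircular]).

    An incidence bound.  The m = O(n D) lines of one family have at most
    O(n^(1/2) m^(3/2) (1 + log n)) coincidences over n abscissas ([sum_mult_le]), an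
    estimate of Szemeredi-Trotter type.  For the incidences of multiplicity at
    least k, follow a line from left to right: any other line crosses it at most
    once, so its rank among the m lines moves by at most m altogether.  Therefore
    most incidences have a successor on the same line that is close in abscissa
    and in rank.  Two distinct points lie on at most one common line, and a point
    of multiplicity k fills k consecutive ranks, so close pairs of such points are
    rare; balancing the two facts bounds the number of incidences by
    O(n^(1/2) m^(3/2) / k) ([incidences_bound]), and summing over k produces the
    harmonic sum.

    Altogether n^3 = O(n^(1/2) (n D)^(3/2) (1 + log n)) with D = O(N/n), which is the
    inequality announced ([expansion]); the logarithm is absorbed by n^eps. *)

Set Implicit Arguments.
Unset Strict Implicit.
Unset Printing Implicit Defensive.

Import Order.TTheory GRing.Theory Num.Theory.

Local Open Scope ring_scope.

(** * Packing in a chain *)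

Section Packing.
Local Open Scope nat_scope.

Variable T : finType.
Implicit Types (Z : {set T}) (r t u : T -> nat).

Lemma card_separated Z r k K : 0 < k ->
    {in Z, forall z, r z <= K} ->
    {in Z &, forall z w, z != w -> (r z + k <= r w) || (r w + k <= r z)} ->
  #|Z| <= (K %/ k).+1.
Proof.
move=> k0 rK sep.
pose f z : 'I_(K %/ k).+1 := inord (r z %/ k).
have fE z : z \in Z -> f z = r z %/ k :> nat.
  by move=> zZ; rewrite inordK // ltnS leq_div2r ?rK.
have inj_f : {in Z &, injective f}.
  move=> z w zZ wZ fzw; apply/eqP; apply: contraT => zw.
  have: r z %/ k = r w %/ k by rewrite -!fE // fzw.
  by case/orP: (sep z w zZ wZ zw) => /(leq_div2r k); rewrite divnDr // divnn k0; lia.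
by rewrite -(card_in_imset inj_f) -[X in _ <= X]card_ord max_card.
Qed.

(** [t] is read as a time along the chain [Z] and [u] as a height.  The successor
    [w] need not be the immediate one. *)
Definition isolated Z t u h g : {set T} :=
  [set z in Z | ~~ [exists w in Z, [&& t z < t w, t w <= t z + h & u w <= u z + g]]].

(** From an isolated point to any later point of the chain, [t] jumps by more than
    [h] or [u] by more than [g], so the increasing weight [g * t + h * u] grows by
    at least [h * g]. *)
Lemma card_isolated Z t u h g K V : 0 < h -> 0 < g ->
    {in Z, forall z, t z <= K} -> {in Z, forall z, u z <= V} ->
    {in Z &, forall z w, z != w ->
      (t z < t w) && (u z <= u w) || (t w < t z) && (u w <= u z)} ->
  #|isolated Z t u h g| <= ((g * K + h * V) %/ (h * g)).+1.
Proof.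
move=> h0 g0 tK uV chain.
apply: (@card_separated _ (fun z => g * t z + h * u z)); first by rewrite muln_gt0 h0.
  by move=> z; rewrite inE => /andP[zZ _]; rewrite leq_add ?leq_mul2l ?tK ?uV ?orbT.
have far z w : z \in isolated Z t u h g -> w \in Z -> t z < t w -> u z <= u w ->
    g * t z + h * u z + h * g <= g * t w + h * u w.
  rewrite inE => /andP[_ /existsPn/(_ w) H] wZ tzw uzw.
  by move: H; rewrite wZ tzw /= negb_and -!ltnNge => /orP[] ?; nia.
move=> z w zI wI zw.
have [zZ wZ] : z \in Z /\ w \in Z.
  by move: zI wI; rewrite !inE => /andP[-> _] /andP[-> _].
by case/orP: (chain z w zZ wZ zw) => /andP[tt uu]; apply/orP; [left|right]; exact: far.
Qed.

End Packing.

(** * Incidences between lines and vertical lines *)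

Section Lines.
Local Open Scope nat_scope.

Lemma card_sum_in (T : finType) (P : {set T}) (b : pred T) :
  #|[set q in P | b q]| = \sum_(q in P) b q.
Proof.
rewrite -sum1_card big_mkcond [RHS]big_mkcond /=.
by apply: eq_bigr => q _; rewrite inE; case: (q \in P); case: (b q).
Qed.

Variables (R : realDomainType) (T : finType) (P : {set T}) (u v : T -> R).
Hypothesis uv_inj : {in P &, forall p q, u p = u q -> v p = v q -> p = q}.

Definition line (s : R) (p : T) : R := (u p * s + v p)%R.
Definition mult s p := #|[set q in P | line s q == line s p]|.
(** Ties share a rank, so the lines through a common point over [s] have the same
    rank, and the next rank above is larger by at least their number
    ([rank_mult]). *)
Definition rank s p := #|[set q in P | (line s q < line s p)%R]|.

Lemma lines_meet_once s t : s != t ->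
  {in P &, forall p q, line s p = line s q -> line t p = line t q -> p = q}.
Proof.
move=> st p q pP qP es et.
have e : ((u p - u q) * (s - t) = 0)%R by rewrite /line in es et; lra.
have uE : u p = u q.
  by apply/eqP; move/eqP: e; rewrite mulf_eq0 !subr_eq0 (negPf st) orbF.
by apply: uv_inj => //; move: es; rewrite /line uE => /addrI.
Qed.

(** The difference of two lines is affine in the abscissa, so its sign changes at
    most once: an order that already differs from the one at [s0] is final. *)
Lemma order_switch_once s0 s1 s2 p q : (s0 <= s1)%R -> (s1 <= s2)%R ->
  (line s1 q < line s1 p)%R != (line s0 q < line s0 p)%R ->
  (line s2 q < line s2 p)%R = (line s1 q < line s1 p)%R.
Proof.
move=> h01 h12; rewrite /line; set w := (u p - u q)%R.
have D s t : (u p * t + v p - (u q * t + v q)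
    = u p * s + v p - (u q * s + v q) + w * (t - s))%R by rewrite /w; ring.
have D1 := D s0 s1; have D2 := D s1 s2.
case: (ltP (u q * s0 + v q)%R) => c0; case: (ltP (u q * s1 + v q)%R) => c1 // _.
  have w0 : (w <= 0)%R by rewrite leNgt; apply/negP => w0; nra.
  by apply/negbTE; rewrite -leNgt; nra.
have w0 : (0 <= w)%R by rewrite leNgt; apply/negP => w0; nra.
by nra.
Qed.

(** A monotone clock for the movement of a line in the ranking: it only grows with
    the abscissa ([order_switch_once]), it never exceeds the number of lines, and
    it controls the variation of the rank ([switches_rank]). *)
Definition switches s0 s p :=
  #|[set q in P | (line s q < line s p)%R != (line s0 q < line s0 p)%R]|.

Lemma switches_rank s0 s t p : (s0 <= s)%R -> (s <= t)%R ->
  (rank s p + switches s0 s p <= rank t p + switches s0 t p)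
  && (rank t p + switches s0 s p <= rank s p + switches s0 t p).
Proof.
move=> s0s st; rewrite /rank /switches !card_sum_in -!big_split /=.
apply/andP; split; apply: leq_sum => q _.
  have := @order_switch_once _ _ _ p q s0s st.
  by do 3![case: (_ < _)%R] => //= /(_ isT).
have := @order_switch_once _ _ _ p q s0s st.
by do 3![case: (_ < _)%R] => //= /(_ isT).
Qed.

Lemma rank_mult s p q : (line s p < line s q)%R -> rank s p + mult s p <= rank s q.
Proof.
move=> lpq; rewrite /rank /mult !card_sum_in -big_split /=.
apply: leq_sum => w _.
case: ltgtP => [lt|lt|->] //=; last by rewrite lpq.
by rewrite (lt_trans lt lpq).
Qed.

Lemma line_rank s p q : line s p = line s q -> rank s p = rank s q.
Proof. by move=> e; rewrite /rank e. Qed.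

Lemma line_mult s p q : line s p = line s q -> mult s p = mult s q.
Proof. by move=> e; rewrite /mult e. Qed.

Definition rich k s := [set p in P | k <= mult s p].

(** The lines counted here start at the same point over [s], hence have distinct
    values over [t]; their ranks over [t] lie in a window of length [2 * g] and are
    pairwise at distance at least [k]. *)
Lemma card_near_rich k g s0 s t q : 0 < k -> (s0 <= s)%R -> (s < t)%R ->
  #|[set p in rich k t |
     (line s p == line s q) && (switches s0 t p <= switches s0 s p + g)]|
    <= ((2 * g) %/ k).+1.
Proof.
move=> k0 s0s st.
(* [rank s q] is the common rank over [s]; the shift by [g] avoids truncation. *)
apply: (@card_separated _ _ (fun p => rank t p + g - rank s q)) => // [p|p p'].
  rewrite !inE => /andP[_ /andP[/eqP/line_rank <- sw]].
  have /andP[] := switches_rank p s0s (ltW st).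
  by lia.
rewrite !inE => /andP[/andP[pP kp] /andP[/eqP lp sw]].
move=> /andP[/andP[pP' kp'] /andP[/eqP lp' sw']] neq.
have /andP[H1 H2] := switches_rank p s0s (ltW st).
have /andP[H1' H2'] := switches_rank p' s0s (ltW st).
have E := line_rank lp; have E' := line_rank lp'.
case: (ltgtP (line t p) (line t p')) => [/rank_mult|/rank_mult|] //; try lia.
move=> et; case/eqP: neq; apply: (@lines_meet_once s t) => //.
  by rewrite lt_eqF.
by rewrite lp lp'.
Qed.

(** Double counting of the pairs (p, q) where p is an edge and q meets p over [s]:
    p has at least [k] partners q, while q has few partners p by
    [card_near_rich]. *)
Lemma card_edges k g s0 s t : 0 < k -> (s0 <= s)%R -> (s < t)%R ->
  k * #|[set p in rich k s :&: rich k t | switches s0 t p <= switches s0 s p + g]|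
    <= #|rich k s| * ((2 * g) %/ k).+1.
Proof.
move=> k0 s0s st; set E := [set p in _ | _].
pose M p q : nat := line s p == line s q.
apply: (@leq_trans (\sum_(p in E) \sum_(q in rich k s) M p q)).
  rewrite mulnC -sum_nat_const; apply: leq_sum => p.
  rewrite !inE => /andP[/andP[/andP[pP kp] _] _].
  apply: (leq_trans kp); rewrite /mult -sum1_card big_mkcond [leqRHS]big_mkcond /=.
  apply: leq_sum => q _; rewrite !inE /M.
  case: (q \in P) => //=; case: eqP => //= e.
  by rewrite (line_mult e) kp e eqxx.
rewrite exchange_big /= -sum_nat_const; apply: leq_sum => q _.
rewrite -card_sum_in; apply: leq_trans (card_near_rich g q k0 s0s st).
apply/subset_leq_card/subsetP => p; rewrite !inE.
by move=> /andP[/andP[/andP[_ ->] ->] ->].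
Qed.

Variable S : seq R.
Hypothesis S_sorted : sorted <%R S.

Lemma nth_sorted_lt i j : i < j -> j < size S -> (S`_i < S`_j)%R.
Proof.
by move=> ij jS; rewrite (sorted_ltn_nth lt_trans) ?inE // (ltn_trans ij).
Qed.

Lemma nth_sorted_le i j : i <= j -> j < size S -> (S`_i <= S`_j)%R.
Proof.
rewrite leq_eqVlt => /predU1P[-> //|ij jS].
by rewrite ltW // nth_sorted_lt.
Qed.

Definition edges k g s t :=
  [set p in rich k s :&: rich k t | switches S`_0 t p <= switches S`_0 s p + g].

Definition incidences k := \sum_(i < size S) #|rich k S`_i|.

Lemma switches_le s p : switches S`_0 s p <= #|P|.
Proof. by apply/subset_leq_card/subsetP => q; rewrite inE => /andP[]. Qed.

(** Along each line, the rich incidences form a chain for the index of the abscissa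
    and for [switches]; those without a close successor are bounded by
    [card_isolated], the others are counted with their edge. *)
Lemma incidences_edges k g h : 0 < h -> 0 < g ->
  incidences k <= #|P| * ((g * size S + h * #|P|) %/ (h * g)).+1
   + \sum_(i < size S) \sum_(j < size S | i < j <= i + h) #|edges k g S`_i S`_j|.
Proof.
move=> h0 g0.
pose Z p := [set i : 'I_(size S) | k <= mult S`_i p].
pose sw p (i : 'I_(size S)) := switches S`_0 S`_i p.
have -> : incidences k = \sum_(p in P) #|Z p|.
  transitivity (\sum_(i < size S) \sum_(p in P) (k <= mult S`_i p)).
    by apply: eq_bigr => i _; exact: card_sum_in.
  rewrite exchange_big /=; apply: eq_bigr => p _.
  by rewrite -sum1_card [RHS]big_mkcond /=; apply: eq_bigr => i _; rewrite inE.
rewrite -sum_nat_const.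
have -> : \sum_(i < size S) \sum_(j < size S | i < j <= i + h)
     #|edges k g S`_i S`_j| =
   \sum_(p in P) \sum_(i < size S) \sum_(j < size S | i < j <= i + h)
     (p \in edges k g S`_i S`_j).
  rewrite [RHS]exchange_big /=; apply: eq_bigr => i _.
  rewrite [RHS]exchange_big /=; apply: eq_bigr => j _.
  rewrite -sum1_card big_mkcond [RHS]big_mkcond; apply: eq_bigr => p _ /=.
  by rewrite !inE; case: (p \in P) => /=; do 3!case: (_ <= _).
rewrite -big_split /=; apply: leq_sum => p pP.
have isoZ : isolated (Z p) (@nat_of_ord _) (sw p) h g \subset Z p.
  by apply/subsetP => i; rewrite inE => /andP[].
rewrite -(cardsID (isolated (Z p) (@nat_of_ord _) (sw p) h g) (Z p)) (setIidPr isoZ).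
apply: leq_add.
  apply: card_isolated => // [i _|i _|i j _ _].
  - exact: ltnW (ltn_ord i).
  - exact: switches_le.
  have le_sw (a b : 'I_(size S)) : a < b -> sw p a <= sw p b.
    move=> ab; have /andP[] := switches_rank p
      (nth_sorted_le (leq0n a) (ltn_ord a)) (ltW (nth_sorted_lt ab (ltn_ord b))).
    by rewrite /sw; lia.
  by rewrite -val_eqE /=; case: ltngtP => //= /le_sw ->.
rewrite -sum1_card big_mkcond /=; apply: leq_sum => i _.
rewrite !inE negb_and negbK; case: ifP => // /andP[/orP[/negP|/existsP[j]]] //.
move=> /andP[jZ /and3P[ij jih swij]] ki.
rewrite (bigD1 j) ?ij ?jih //= !inE pP ki.
by move: jZ; rewrite inE => ->; rewrite -/(sw p j) -/(sw p i) swij.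
Qed.

Lemma card_ord_window m i h : #|[pred j : 'I_m | i < j <= i + h]| <= h.
Proof.
case: h => [|h]; first by rewrite eq_card0 // => j; rewrite !inE; lia.
rewrite -cardsE -[h in _ <= h.+1]divn1.
apply: (@card_separated _ _ (fun j : 'I_m => j - i.+1)) => // [j|j j'].
  by rewrite !inE; lia.
by rewrite !inE -val_eqE /=; lia.
Qed.

Lemma sum_edges k g h : 0 < k ->
  k * (\sum_(i < size S) \sum_(j < size S | i < j <= i + h) #|edges k g S`_i S`_j|)
    <= h * ((2 * g) %/ k).+1 * incidences k.
Proof.
move=> k0; rewrite big_distrr /= mulnC /incidences big_distrl /=.
apply: leq_sum => i _; rewrite big_distrr /=.
apply: (@leq_trans (\sum_(j < size S | i < j <= i + h)
    #|rich k S`_i| * ((2 * g) %/ k).+1)).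
  apply: leq_sum => j /andP[ij _].
  by apply: card_edges => //; [exact: nth_sorted_le|exact: nth_sorted_lt].
rewrite sum_nat_const mulnCA leq_mul2l.
by rewrite leq_mul2r card_ord_window ?orbT.
Qed.

(** Balances the two terms of [incidences_edges].  The choice [h] of order [k / L]
    makes [h * (2 * g %/ k).+1] at most [3 * k / 8], so that the edges account for
    at most 3/8 of the incidences by [sum_edges], and [g = h * L ^ 2] equalizes the
    two contributions to the isolated incidences.  The hypothesis [k <= 2 * n]
    absorbs the one isolated incidence that every line may have. *)
Lemma incidences_bound L n k : 0 < L -> size S <= n -> #|P| <= n * L ^ 2 ->
  0 < k <= 2 * n -> k * incidences k <= 36 * n ^ 2 * L ^ 3.
Proof.
move=> L0 Sn PnL /andP[k0 kn].
(* Below [4 * L] there is no room for [h], but all incidences together suffice. *)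
have [kL|Lk] := ltnP k (4 * L).
  have : incidences k <= n * (n * L ^ 2).
    apply: (@leq_trans (\sum_(i < size S) #|P|)).
      apply: leq_sum => i _; apply/subset_leq_card/subsetP => p.
      by rewrite inE => /andP[].
    by rewrite sum_nat_const card_ord leq_mul.
  set I := incidences k; move=> HI.
  apply: (@leq_trans (4 * L * (n * (n * L ^ 2)))); first by rewrite leq_mul // ltnW.
  by rewrite !expnS !expn0 !muln1; nia.
pose h := k %/ (4 * L); pose g := h * L ^ 2.
have h0 : 0 < h by rewrite divn_gt0 ?muln_gt0.
have L2 : 0 < L ^ 2 by rewrite expn_gt0 L0.
have g0 : 0 < g by rewrite muln_gt0 h0.
have hk : h * (4 * L) <= k by exact: leq_trunc_div.
have kh : k < h.+1 * (4 * L) by rewrite -ltn_divLR // muln_gt0.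
have E1 := @incidences_edges k g h h0 g0.
have E2 := @sum_edges k g h k0.
move: E1 E2; set E := \sum_(i < _) _; set I := incidences k => E1 E2.
have B1 : (g * size S + h * #|P|) %/ (h * g) <= 2 * n %/ h.
  rewrite leq_divRL // -(leq_pmul2r g0) -mulnA.
  apply: leq_trans (leq_trunc_div _ _) _.
  have H1 : g * size S <= g * n by rewrite leq_mul2l Sn orbT.
  have H2 : h * #|P| <= h * (n * L ^ 2) by rewrite leq_mul2l PnL orbT.
  apply: leq_trans (leq_add H1 H2) _.
  by rewrite leq_eqVlt; apply/orP; left; apply/eqP; rewrite /g; ring.
have B2 : 8 * (h * (2 * g %/ k).+1) <= 3 * k.
  have := leq_trunc_div (2 * g) k; set q := _ %/ _ => qk.
  have hLk : h * L * 4 <= k by rewrite -mulnA (mulnC L).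
  have h4 : h * 4 <= k by apply: leq_trans hLk; rewrite leq_mul2r leq_pmulr.
  suff : 8 * h * q <= k by move: h4; clear; lia.
  rewrite -(leq_pmul2r k0) -mulnA.
  apply: leq_trans (leq_mul (leqnn (8 * h)) qk) _.
  suff -> : 8 * h * (2 * g) = (h * L * 4) * (h * L * 4) by exact: leq_mul.
  by rewrite /g; ring.
have B3 : I <= 2 * #|P| * (2 * n %/ h).+1.
  set q := (_ %/ _).+1 in B2 E2; set b := (_ %/ _) in B1 E1 *.
  set c := _ %/ h in B1 *.
  have E1' : k * I <= k * (#|P| * c.+1) + k * E.
    by rewrite -mulnDr leq_mul2l (leq_trans E1) ?orbT // leq_add2r leq_mul2l ltnS B1 orbT.
  have E2' : 8 * (k * E) <= 3 * (k * I).
    apply: (@leq_trans (8 * (h * q) * I)); first by rewrite -mulnA leq_mul2l E2 orbT.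
    by rewrite [leqRHS]mulnA leq_mul2r B2 orbT.
  by rewrite -(leq_pmul2l k0); move: E1' E2'; clear; lia.
have := leq_trunc_div (2 * n) h; set c := _ %/ h in B3 * => ch.
have kc : k * c.+1 <= 18 * (n * L).
  have khL : k <= 8 * L * h by move: kh h0; clear; nia.
  have := leq_mul (leqnn (8 * L)) ch; have := leq_mul khL (leqnn c).
  have := leq_mul (leqnn n) L0.
  by move: kn; clear; rewrite mulnS; lia.
apply: (@leq_trans (2 * (n * L ^ 2) * (k * c.+1))).
  rewrite [leqRHS]mulnCA leq_mul // (leq_trans B3) // leq_mul // leq_mul //.
apply: (@leq_trans (2 * (n * L ^ 2) * (18 * (n * L)))); first by rewrite leq_mul2l kc orbT.
by rewrite leq_eqVlt; apply/orP; left; apply/eqP; ring.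
Qed.

End Lines.

(** * Coincidences among lines *)

Section Collisions.

Definition harmonic_sum (F : fieldType) m : F := \sum_(1 <= k < m.+1) k%:R^-1.

(** A multiplicity [m] is the number of levels [1 <= k <= m], so the sum of the
    multiplicities is the sum over [k] of the numbers of [k]-rich incidences, each
    [O(1/k)] by [incidences_bound]. *)
Lemma sum_mult_le (R : realFieldType) (T : finType) (P : {set T}) (u v : T -> R)
    (S : seq R) (n L : nat) :
    {in P &, forall p q, u p = u q -> v p = v q -> p = q} ->
    (forall s p, mult P u v s p <= 2 * n)%N ->
    (0 < L)%N -> uniq S -> (size S <= n)%N -> (#|P| <= n * L ^ 2)%N ->
  (\sum_(s <- S) \sum_(p in P) mult P u v s p)%:R
    <= (36 * n ^ 2 * L ^ 3)%:R * harmonic_sum R (2 * n).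
Proof.
move=> uv_inj mult_n L0 S_uniq Sn PnL.
pose S' := sort <=%R S.
have S'_sorted : sorted <%R S' by rewrite sort_lt_sorted.
have layers s p : mult P u v s p = (\sum_(1 <= k < (2 * n).+1) (k <= mult P u v s p))%N.
  have := mult_n s p; set m := mult P u v s p.
  elim: (2 * n)%N => [|b IH] le_m; first by rewrite big_geq //; lia.
  move: le_m; rewrite big_nat_recr //= leq_eqVlt ltnS => /predU1P[E|/[dup] le_m /IH {1}->].
    rewrite -E leqnn (eq_big_nat _ _ (F2 := fun=> 1%N)) => [|k /andP[_ km]].
      by rewrite sum_nat_const_nat; lia.
    by rewrite ltnW.
  by rewrite (leqNgt b.+1) ltnS le_m addn0.
have -> : (\sum_(s <- S) \sum_(p in P) mult P u v s p
    = \sum_(1 <= k < (2 * n).+1) incidences P u v S' k)%N.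
  rewrite -(perm_big _ (permEl (perm_sort <=%R S))) /= -/S' (big_nth 0) big_mkord.
  rewrite /incidences [RHS]exchange_big /=; apply: eq_bigr => i _.
  transitivity (\sum_(1 <= k < (2 * n).+1)
      \sum_(p in P) (k <= mult P u v S'`_i p)%N)%N; last first.
    by apply: eq_bigr => k _; rewrite -card_sum_in.
  rewrite [RHS]exchange_big /=; apply: eq_bigr => p _.
  exact: layers.
rewrite natr_sum /harmonic_sum mulr_sumr.
rewrite big_nat [leRHS]big_nat; apply: ler_sum => k /andP[k0 kn].
rewrite ler_pdivlMr ?ltr0n // -natrM ler_nat mulnC.
apply: incidences_bound => //; last by rewrite k0 -ltnS.
by rewrite size_sort.
Qed.

(** If [w f k] is the number of [p] with [f p = k], the left side is twice the sum of
    [w f k * w g k] and the right side the sum of [w f k ^ 2 + w g k ^ 2]. *)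
Lemma collisions_AMGM (E : eqType) (T : finType) (P : {set T}) (f g : T -> E) :
  (2 * \sum_(p in P) \sum_(q in P) (f p == g q)
    <= \sum_(p in P) #|[set q in P | f q == f p]|
     + \sum_(p in P) #|[set q in P | g q == g p]|)%N.
Proof.
pose V := undup (codom f ++ codom g).
have fV p : f p \in V by rewrite mem_undup mem_cat codom_f.
have gV p : g p \in V by rewrite mem_undup mem_cat codom_f orbT.
pose w h (k : E) := (\sum_(p in P) (h p == k))%N.
have sumE (h h' : T -> E) : (forall p, h p \in V) ->
    (\sum_(p in P) \sum_(q in P) (h p == h' q) = \sum_(k <- V) w h k * w h' k)%N.
  move=> hV; transitivity (\sum_(p in P) \sum_(q in P) \sum_(k <- V)
      (h p == k) * (h' q == k))%N.
    apply: eq_bigr => p _; apply: eq_bigr => q _.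
    rewrite (bigD1_seq (h p)) ?undup_uniq //= eqxx mul1n big1 ?addn0 1?eq_sym //.
    by move=> k; rewrite eq_sym => /negPf ->.
  under eq_bigr do rewrite exchange_big /=.
  rewrite exchange_big /=; apply: eq_bigr => k _.
  by rewrite /w big_distrl /=; apply: eq_bigr => p _; rewrite big_distrr.
have sqE (h : T -> E) : (forall p, h p \in V) ->
    (\sum_(p in P) #|[set q in P | h q == h p]| = \sum_(k <- V) w h k * w h k)%N.
  move=> hV; rewrite -sumE //; apply: eq_bigr => p _.
  by rewrite card_sum_in; apply: eq_bigr => q _; rewrite eq_sym.
rewrite sumE // !sqE // big_distrr -big_split /=; apply: leq_sum => k _.
by rewrite !mulnn nat_Cauchy.
Qed.

Lemma sum_fibers (X Y : eqType) (A : seq X) (h : X -> Y) (d : nat) (G : Y -> nat) :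
    (forall y, count (fun a => h a == y) A <= d)%N ->
  (\sum_(a <- A) G (h a) <= d * \sum_(y <- undup (map h A)) G y)%N.
Proof.
move=> fib; set U := undup _.
apply: (@leq_trans (\sum_(a <- A) \sum_(y <- U) (h a == y) * G y)%N).
  rewrite big_seq [leqRHS]big_seq; apply: leq_sum => a aA.
  rewrite (bigD1_seq (h a)) ?undup_uniq //=; first by rewrite eqxx mul1n leq_addr.
  by rewrite mem_undup map_f.
rewrite exchange_big big_distrr /=; apply: leq_sum => y _.
rewrite -big_distrl leq_mul //; apply: leq_trans (fib y).
by rewrite -sum1_count [leqRHS]big_mkcond leq_sum // => a _ /=; case: eqP.
Qed.

End Collisions.

(** * Cocircular pairs of grid points *)

Section Grid.

Variables (R : realFieldType) (n : nat).
Implicit Types (b c : 'I_n -> R) (p q z w : 'I_n * 'I_n).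

Lemma card_set_pair (T1 T2 : finType) (Q : {set T1 * T2}) :
  #|Q| = (\sum_i #|[set j | (i, j) \in Q]|)%N.
Proof.
transitivity (\sum_i \sum_j ((i, j) \in Q))%N.
  rewrite pair_big -sum1_card big_mkcond /=.
  by apply: eq_bigr => -[i j] _ /=; case: (_ \in Q).
apply: eq_bigr => i _; rewrite -sum1_card [RHS]big_mkcond /=.
by apply: eq_bigr => j _; rewrite inE; case: (_ \in Q).
Qed.

Lemma incr_inj (f : 'I_n -> R) : {homo f : i j / (i < j)%N >-> i < j} -> injective f.
Proof.
move=> f_incr i j E; apply/eqP; rewrite -val_eqE /=.
by case: ltngtP => // /f_incr; rewrite E ltxx.
Qed.

(** The diagonal is left out since it would give several times the zero line. *)
Definition close_pairs (D : nat) : {set 'I_n * 'I_n} :=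
  [set p : 'I_n * 'I_n | [&& p.1 != p.2, (p.1 <= p.2 + D)%N & (p.2 <= p.1 + D)%N]].

Lemma card_close_pairs D : (#|close_pairs D| <= n * (2 * D).+1)%N.
Proof.
rewrite card_set_pair.
rewrite -[n in leqRHS]card_ord -sum_nat_const; apply: leq_sum => i _.
rewrite -[(2 * D)%N in leqRHS]divn1.
apply: (@card_separated _ _ (fun j : 'I_n => j + D - i)%N) => // [j|j j'].
  by rewrite !inE /= => /and3P[_]; lia.
by rewrite !inE /= -!val_eqE /=; lia.
Qed.

(** Slope and intercept of [s |-> (b p.2 - s)^2 - (b p.1 - s)^2], an affine function
    of [s] ([sqdiff_lineE]). *)
Definition sqdiff_slope b p := - 2 * (b p.2 - b p.1).
Definition sqdiff_const b p := b p.2 ^+ 2 - b p.1 ^+ 2.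
Notation sqdiff_line b := (line (sqdiff_slope b) (sqdiff_const b)).

Lemma sqdiff_lineE b s p : sqdiff_line b s p = (b p.2 - s) ^+ 2 - (b p.1 - s) ^+ 2.
Proof. by rewrite /line /sqdiff_slope /sqdiff_const; ring. Qed.

(** The slope determines the difference of the two values of [b], and then the
    intercept determines their sum. *)
Lemma sqdiff_inj b D : injective b -> {in close_pairs D &, forall p q,
  sqdiff_slope b p = sqdiff_slope b q -> sqdiff_const b p = sqdiff_const b q -> p = q}.
Proof.
move=> b_inj [i i'] [j j']; rewrite !inE /= => /and3P[neq _ _] _ E1 E2.
rewrite /sqdiff_slope /sqdiff_const /= in E1 E2.
have neqb : b i' - b i != 0 by rewrite subr_eq0 eq_sym; apply: contra_neq neq => /b_inj.
have D1 : b j' - b j = b i' - b i by lra.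
have D2 : b j' + b j = b i' + b i.
  apply: (mulfI neqb); rewrite -[in LHS]D1.
  by transitivity (b j' ^+ 2 - b j ^+ 2); [ring | rewrite -E2; ring].
by congr pair; apply: b_inj; lra.
Qed.

Lemma card_sqdist_eq b s e : injective b -> (#|[set i | (b i - s) ^+ 2 == e]| <= 2)%N.
Proof.
move=> b_inj; rewrite -[leqRHS]card_bool; set Z := [set i | _].
suff f_inj : {in Z &, injective (fun i => s <= b i)}.
  by rewrite -(card_in_imset f_inj) max_card.
move=> i j; rewrite !inE => /eqP ei /eqP ej E; apply: b_inj.
have /eqP : (b i - s) ^+ 2 = (b j - s) ^+ 2 by rewrite ei ej.
rewrite eqf_sqr => /orP[/eqP|/eqP]; first by lra.
by case: (leP s (b i)) (leP s (b j)) E => ? [] // *; lra.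
Qed.

(** Once [q.1] is chosen, [b q.2] is a root of a quadratic equation. *)
Lemma mult_sqdiff b (P : {set 'I_n * 'I_n}) s p : injective b ->
  (mult P (sqdiff_slope b) (sqdiff_const b) s p <= 2 * n)%N.
Proof.
move=> b_inj; rewrite /mult.
set e := line _ _ s p.
apply: (@leq_trans #|[set q | sqdiff_line b s q == e]|).
  by apply/subset_leq_card/subsetP => q; rewrite !inE => /andP[].
rewrite card_set_pair.
rewrite mulnC -[n in leqRHS]card_ord -sum_nat_const; apply: leq_sum => i _.
apply: leq_trans (card_sqdist_eq s (e + (b i - s) ^+ 2) b_inj).
by apply/subset_leq_card/subsetP => j; rewrite !inE sqdiff_lineE subr_eq.
Qed.

Definition sqdiff_collisions b D s :=
  (\sum_(p in close_pairs D) mult (close_pairs D) (sqdiff_slope b) (sqdiff_const b) s p)%N.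

Lemma sum_sqdiff_collisions b l (S : seq R) : injective b -> (0 < l)%N ->
    uniq S -> (size S <= n)%N ->
  (\sum_(s <- S) sqdiff_collisions b (l ^ 2) s)%:R
    <= (36 * n ^ 2 * (2 * l) ^ 3)%:R * harmonic_sum R (2 * n).
Proof.
move=> b_inj l0 S_uniq Sn; apply: sum_mult_le => //.
- exact: sqdiff_inj.
- by move=> s p; exact: mult_sqdiff.
- by rewrite muln_gt0.
- apply: leq_trans (card_close_pairs _) _; rewrite leq_mul2l expnMn.
  by apply/orP; right; have : (0 < l ^ 2)%N by [rewrite expn_gt0 l0]; lia.
Qed.

Definition sqdist b c s t z := (s - b z.1) ^+ 2 + (t - c z.2) ^+ 2.

Lemma circle_quadrant_monotone (s t x y x' y' : R) :
    (s - x) ^+ 2 + (t - y) ^+ 2 = (s - x') ^+ 2 + (t - y') ^+ 2 ->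
    x < x' -> (s <= x') = (s <= x) -> (t <= y') = (t <= y) ->
  if (s <= x) == (t <= y) then y' < y else y < y'.
Proof.
move=> E lt_x.
case: (leP s x) => sx; case: (leP s x') => sx' // _;
case: (leP t y) => ty; case: (leP t y') => ty' //= _; rewrite ltNge; apply/negP => le_y.
- have : (x - s) ^+ 2 < (x' - s) ^+ 2 by nra.
  by nra.
- have : (x - s) ^+ 2 < (x' - s) ^+ 2 by nra.
  by nra.
- have : (x' - s) ^+ 2 < (x - s) ^+ 2 by nra.
  by nra.
- have : (x' - s) ^+ 2 < (x - s) ^+ 2 by nra.
  by nra.
Qed.

(** The first coordinate orients the step; the second one may move either way, since
    it decreases along half of the quarter circles. *)
Definition near (D : nat) z w :=
  [&& z.1 < w.1, w.1 <= z.1 + D, z.2 != w.2, z.2 <= w.2 + D & w.2 <= z.2 + D]%N.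

Definition near_cocircular b c s t D :=
  [set zw : ('I_n * 'I_n) * ('I_n * 'I_n) |
    near D zw.1 zw.2 && (sqdist b c s t zw.1 == sqdist b c s t zw.2)].

(** A cocircular pair [(z, w)] equates a difference of squares in [b] with one in
    [c], taken in the opposite order; [h] regroups the coordinates accordingly. *)
Lemma card_near_cocircular b c s t D :
  (2 * #|near_cocircular b c s t D| <= sqdiff_collisions b D s + sqdiff_collisions c D t)%N.
Proof.
apply: leq_trans (collisions_AMGM (close_pairs D) (sqdiff_line b s) (sqdiff_line c t)).
rewrite leq_mul2l /=.
pose h (zw : ('I_n * 'I_n) * ('I_n * 'I_n)) := ((zw.1.1, zw.2.1), (zw.2.2, zw.1.2)).
have h_inj : injective h by move=> [[? ?] [? ?]] [[? ?] [? ?]] [-> -> -> ->].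
rewrite pair_big_dep /= -(card_imset _ h_inj) -sum1_card big_mkcond [leqRHS]big_mkcond /=.
apply: leq_sum => x _; case: imsetP => // -[[z w]] hx ->.
rewrite !inE /= !sqdiff_lineE; move: hx; rewrite inE /near /sqdist /=.
move=> /andP[/and5P[zw wz zw2 -> ->] /eqP E] /=.
rewrite (eq_sym w.2) zw2.
rewrite -val_eqE /= (ltn_eqF zw) wz (leq_trans (ltnW zw)) ?leq_addr //=.
by rewrite lt0b; apply/eqP; lra.
Qed.

(** The grid splits into [4 * size V] quarter circles, each a chain once the second
    coordinate is reversed on those where it decreases.  A point that is not
    isolated on its quarter circle starts a near cocircular pair. *)
Lemma card_grid_le b c s t D (V : seq R) :
    {homo b : i j / (i < j)%N >-> i < j} -> {homo c : i j / (i < j)%N >-> i < j} ->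
    (0 < D)%N -> (forall z, sqdist b c s t z \in V) ->
  (n ^ 2 <= 4 * size V * ((2 * n) %/ D).+1 + #|near_cocircular b c s t D|)%N.
Proof.
move=> b_incr c_incr D0 inV.
have c_inj := incr_inj c_incr.
pose arc (d : R) (o : bool * bool) := [set z | [&& sqdist b c s t z == d,
  (s <= b z.1) == o.1 & (t <= c z.2) == o.2]].
pose height (o : bool * bool) z : nat := if o.1 == o.2 then (n - z.2)%N else z.2.
pose iso d o := isolated (arc d o) (fun z => z.1 : nat) (height o) D D.
have chain d o z w : z \in arc d o -> w \in arc d o -> (z.1 < w.1)%N ->
    z.2 != w.2 /\ (height o z <= height o w)%N.
  rewrite !inE => /and3P[/eqP zd /eqP z1 /eqP z2] /and3P[/eqP wd /eqP w1 /eqP w2] /b_incr zw.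
  rewrite -wd in zd; rewrite -z1 in w1; rewrite -z2 in w2.
  have := circle_quadrant_monotone zd zw w1 w2; rewrite /height -z1 -z2.
  case: (ltngtP z.2 w.2) => [lt|lt|/val_inj ->]; last by rewrite ltxx if_same.
    by case: ifP => _ H; split; rewrite -?val_eqE /= ?ltn_eqF ?(ltnW lt) //;
      move: H; rewrite ltNge (ltW (c_incr _ _ lt)).
  case: ifP => _ H; split; rewrite -?val_eqE /= ?gtn_eqF ?leq_sub2l ?(ltnW lt) //;
    by move: H; rewrite ltNge (ltW (c_incr _ _ lt)).
have iso_le d o : (#|iso d o| <= ((2 * n) %/ D).+1)%N.
  rewrite -(divnMl D0) mulnCA mul2n -addnn.
  apply: card_isolated => // [z _|z _|z w zd wd zw].
  - exact: ltnW.
  - by rewrite /height; case: ifP => _; [exact: leq_subr|exact: ltnW].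
  case: (ltngtP z.1 w.1) => [/(chain _ _ _ _ zd wd)[_ ->]|/(chain _ _ _ _ wd zd)[_ ->]|] //.
  move=> /val_inj E1; case/eqP: zw.
  rewrite [z]surjective_pairing [w]surjective_pairing E1; congr pair; apply: c_inj.
  move: zd wd; rewrite !inE => /and3P[/eqP zd _ /eqP z2] /and3P[/eqP wd _ /eqP w2].
  rewrite -wd /sqdist E1 in zd; rewrite -w2 in z2.
  have : (c z.2 - t) ^+ 2 = (c w.2 - t) ^+ 2 by lra.
  move/eqP; rewrite eqf_sqr => /orP[/eqP|/eqP]; first by lra.
  by case: (leP t (c z.2)) (leP t (c w.2)) z2 => ? [] // *; lra.
pose K := near_cocircular b c s t D.
have cover z : (1 <= \sum_(d <- V) \sum_(o : bool * bool) (z \in iso d o)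
    + \sum_w ((z, w) \in K))%N.
  pose o := (s <= b z.1, t <= c z.2); pose d := sqdist b c s t z.
  have zarc : z \in arc d o by rewrite inE !eqxx.
  case: (boolP (z \in iso d o)) => zi.
    by rewrite (big_rem d (inV z)) (bigD1 o) // zi.
  move: zi; rewrite inE zarc negbK => /existsP[w /and4P[warc zw wz hw]].
  have [neq hz] := chain _ _ _ _ zarc warc zw.
  suff wK : (z, w) \in K by rewrite addnC (bigD1 w) //= wK.
  rewrite inE /near /= zw wz neq; move: warc; rewrite inE => /and3P[/eqP -> _ _].
  move: hz hw; rewrite /height eqxx andbT.
  by have := ltn_ord z.2; have := ltn_ord w.2; case: ifP => _; lia.
have -> : (n ^ 2 = \sum_(z : 'I_n * 'I_n) 1)%N.
  by rewrite sum1_card card_prod card_ord.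
apply: leq_trans (leq_sum _ (fun z _ => cover z)) _.
rewrite big_split /= leq_add //.
  rewrite exchange_big /=.
  apply: (@leq_trans (\sum_(d <- V) 4 * ((2 * n) %/ D).+1)%N); last first.
    by rewrite big_const_seq count_predT iter_addn_0 mulnC mulnCA mulnA.
  apply: leq_sum => d _; rewrite exchange_big /=.
  have -> : 4%N = #|{: bool * bool}| by rewrite card_prod card_bool.
  rewrite -sum_nat_const; apply: leq_sum => o _; apply: leq_trans (iso_le d o).
  by rewrite -sum1_card [leqRHS]big_mkcond /= leq_sum // => z _; case: (_ \in _).
rewrite pair_big /= -sum1_card [leqRHS]big_mkcond /= leq_sum // => -[z w] _ /=.
by case: (_ \in _).
Qed.

End Grid.

(** * The expansion inequality *)

Section Expansion.

Variables (R : realFieldType) (n d : nat) (A V : seq R) (h : R -> R) (b c : 'I_n -> R).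
Hypothesis n0 : (0 < n)%N.
Hypothesis A_uniq : uniq A.
Hypothesis A_size : size A = n.
Hypothesis b_incr : {homo b : i j / (i < j)%N >-> i < j}.
Hypothesis c_incr : {homo c : i j / (i < j)%N >-> i < j}.
Hypothesis fib : forall y, (count (fun a => h a == y) A <= d)%N.
Hypothesis inV : forall a z, a \in A -> sqdist b c a (h a) z \in V.

(** Fix [a] and the last coordinate: a value is then attained at most twice. *)
Lemma size_values_ge : (n <= 2 * size V)%N.
Proof.
have [a aA] : exists a, a \in A.
  by exists (nth 0 A 0); rewrite mem_nth // A_size.
pose j := Ordinal n0.
pose X v := [set i | (b i - a) ^+ 2 == v - (h a - c j) ^+ 2].
rewrite -[n in leqLHS]card_ord -sum1_card.
apply: (@leq_trans (\sum_(i < n) \sum_(v <- V) (i \in X v))%N).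
  apply: leq_sum => i _; rewrite (big_rem _ (inV (i, j) aA)) inE /sqdist addrK -sqrrN opprB eqxx.
  by [].
rewrite exchange_big /=; apply: (@leq_trans (\sum_(v <- V) 2)%N).
  apply: leq_sum => v _; apply: leq_trans (card_sqdist_eq a (v - (h a - c j) ^+ 2) (incr_inj b_incr)).
  by rewrite -sum1_card [leqRHS]big_mkcond leq_sum // => i _; case: (_ \in _).
by rewrite big_const_seq count_predT iter_addn_0.
Qed.

Let H := harmonic_sum R (2 * n).

Lemma sum_near_cocircular l : (0 < l)%N ->
  (\sum_(a <- A) #|near_cocircular b c a (h a) (l ^ 2)|)%:R *+ 2
    <= d.+1%:R * ((36 * n ^ 2 * (2 * l) ^ 3)%:R * H).
Proof.
move=> l0.
have b_inj := incr_inj b_incr; have c_inj := incr_inj c_incr.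
rewrite -mulr_natl -natrM big_distrr /=.
apply: (@le_trans _ _ (\sum_(a <- A) sqdiff_collisions b (l ^ 2) a
    + d * \sum_(y <- undup (map h A)) sqdiff_collisions c (l ^ 2) y)%N%:R).
  rewrite ler_nat; apply: leq_trans (leq_sum _ (fun a _ => card_near_cocircular b c a (h a) _)) _.
  by rewrite big_split leq_add2l sum_fibers.
rewrite -add1n [(1 + d)%N%:R]natrD mulrDl mul1r natrD natrM lerD //.
  by apply: sum_sqdiff_collisions; rewrite ?A_size.
apply: ler_wpM2l => //; apply: sum_sqdiff_collisions; rewrite ?undup_uniq //.
by rewrite (leq_trans (size_undup _)) // size_map A_size.
Qed.

Lemma harmonic_ge1 : 1 <= H.
Proof.
rewrite /H /harmonic_sum big_ltn ?ltnS ?muln_gt0 // invr1 lerDl.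
by apply: sumr_ge0 => k _; rewrite invr_ge0 ler0n.
Qed.

(** The scale of closeness is a square [l ^ 2], which keeps the parameters of the
    incidence bound integral.  It is the least one with [32 N <= n l^2], so that,
    summed over [a], at least half of the grid points start a near cocircular pair;
    minimality and
    [size_values_ge] give [n l^2 <= 128 N].  The bound on near cocircular pairs
    becomes [n <= 288 (d+1) l^3 H], and squaring trades [l] for [N]. *)
Lemma expansion :
  n%:R ^+ 5 <= (288 * d.+1%:R) ^+ 2 * (128 * (size V)%:R) ^+ 3 * H ^+ 2.
Proof.
have H1 := harmonic_ge1.
have nV := size_values_ge.
set N := size V in nV *.
have N0 : (0 < N)%N by move: n0 nV; lia.
have n1 : 1 <= n%:R :> R by rewrite ler1n.
(* With so many values the bound is trivial; otherwise the additive constant in the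
   count of isolated points is harmless. *)
have [small|big] := ltnP (n ^ 2) (16 * N).
  apply: (@le_trans _ _ ((128 * N%:R) ^+ 3)).
    apply: (@le_trans _ _ ((n%:R ^+ 2) ^+ 3)).
      by rewrite -exprM ler_weXn2l.
    apply: lerXn2r; rewrite ?nnegrE ?exprn_ge0 ?mulr_ge0 ?ler0n //.
    apply: (@le_trans _ _ (16 * N)%:R); first by rewrite -natrX ler_nat ltnW.
    by rewrite natrM ler_wpM2r ?ler0n // ler_nat.
  rewrite mulrAC ler_peMl ?exprn_ge0 ?mulr_ge0 ?ler0n //.
  rewrite -exprMn exprn_ege1 // -[leLHS]mulr1 ler_pM //.
  by rewrite -natrM ler1n muln_gt0.
have exl : exists l, (32 * N <= n * l ^ 2)%N.
  by exists (32 * N)%N; rewrite -mulnn mulnA leq_pmull // muln_gt0 n0 muln_gt0.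
case: (ex_minnP exl) => l Nl l_min.
have l0 : (0 < l)%N.
  by rewrite lt0n; apply/eqP => l0; move: Nl; rewrite l0 muln0 leqn0 muln_eq0 /= eqn0Ngt N0.
have lN : (n * l ^ 2 <= 128 * N)%N.
  have [l1|l2] := leqP l 1.
    have -> : l = 1%N by apply/eqP; rewrite eqn_leq l1.
    by rewrite muln1 (leq_trans nV) // leq_mul2r orbT.
  have : (n * l.-1 ^ 2 < 32 * N)%N.
    by rewrite ltnNge; apply/negP => /l_min; rewrite leqNgt ltn_predL l0.
  case: l l2 {l0 Nl l_min} => // l l1 /=; rewrite ltnS in l1; move: n0; clear -l1.
  by rewrite -!mulnn; nia.
pose Q := (\sum_(a <- A) #|near_cocircular b c a (h a) (l ^ 2)|)%N.
have nQ : (n ^ 3 <= 2 * Q)%N.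
  have l20 : (0 < l ^ 2)%N by rewrite expn_gt0 l0.
  have : (\sum_(a <- A) n ^ 2
     <= \sum_(a <- A) (4 * N * ((2 * n) %/ l ^ 2).+1
                        + #|near_cocircular b c a (h a) (l ^ 2)|))%N.
    rewrite big_seq [leqRHS]big_seq; apply: leq_sum => a aA.
    by apply: card_grid_le => // z; exact: inV.
  rewrite big_split -/Q /= !big_const_seq !count_predT !iter_addn_0 A_size.
  have := leq_trunc_div (2 * n) (l ^ 2); set q := (_ %/ _)%N => ql.
  have Nq : (16 * N * q <= n ^ 2)%N.
    rewrite -(leq_pmul2r l20) -mulnA; apply: leq_trans (leq_mul (leqnn _) ql) _.
    by rewrite -mulnn -mulnA; move: (leq_mul (leqnn n) Nl); clear; lia.
  have := leq_mul (leqnn n) Nq; have := leq_mul (leqnn n) big.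
  by rewrite (expnS n 2); clear; lia.
have n_le : n%:R <= 288 * d.+1%:R * l%:R ^+ 3 * H.
  have := sum_near_cocircular l0; rewrite -/Q -mulr_natl -natrM => HQ.
  have n20 : 0 < n%:R ^+ 2 :> R by rewrite exprn_gt0 // ltr0n.
  rewrite -(ler_pM2l n20) -exprSr -(natrX _ n 3).
  have nQR : (n ^ 3)%:R <= (2 * Q)%:R :> R by rewrite ler_nat.
  apply: le_trans (le_trans nQR HQ) _.
  by rewrite !(natrM, natrX) le_eqVlt; apply/orP; left; apply/eqP; ring.
have n2_le : n%:R ^+ 2 <= (288 * d.+1%:R) ^+ 2 * H ^+ 2 * (l%:R ^+ 2) ^+ 3.
  apply: (@le_trans _ _ ((288 * d.+1%:R * l%:R ^+ 3 * H) ^+ 2)).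
    by apply: lerXn2r n_le; rewrite nnegrE ?mulr_ge0 ?exprn_ge0 ?ler0n ?(le_trans ler01).
  by rewrite le_eqVlt; apply/orP; left; apply/eqP; ring.
rewrite (exprD _ 3 2) [leRHS]mulrAC.
apply: le_trans (ler_wpM2l (exprn_ge0 3 (ler0n R n)) n2_le) _.
rewrite [leLHS]mulrCA; apply: ler_wpM2l; first by rewrite mulr_ge0 ?sqr_ge0.
rewrite -exprMn.
apply: lerXn2r; rewrite ?nnegrE ?mulr_ge0 ?exprn_ge0 ?ler0n //.
by rewrite -natrX -!natrM ler_nat.
Qed.

End Expansion.

(** * Absorbing the logarithm *)

Lemma harmonic_le_ln (R : realType) (m : nat) :
  harmonic_sum R m.+1 <= 1 + ln m.+1%:R.
Proof.
elim: m => [|m IH]; first by rewrite /harmonic_sum big_nat1 invr1 ln1 addr0.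
rewrite /harmonic_sum big_nat_recr //=.
have m1 : 0 < m.+1%:R :> R by rewrite ltr0n.
have m2 : 0 < m.+2%:R :> R by rewrite ltr0n.
(* [1/(m+2) <= ln (m+2) - ln (m+1)], from [ln (1 + x) <= x] at [x = - 1/(m+2)] *)
suff step : m.+2%:R^-1 <= ln m.+2%:R - ln m.+1%:R :> R.
  by apply: le_trans (lerD IH step) _; rewrite -addrA lerD2l addrC subrK.
rewrite -lerN2 opprB -ln_div ?posrE //.
have -> : m.+1%:R / m.+2%:R = 1 + - m.+2%:R^-1 :> R.
  by apply: (mulIf (lt0r_neq0 m2)); rewrite mulrDl mulNr !mulVf ?mulfVK ?lt0r_neq0 //;
     rewrite -[m.+2%:R]natr1; ring.
by rewrite le_ln1Dx // ltrN2 invf_lt1 // ltr1n.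
Qed.

(** Uses [ln x < x] at [x = n `^ r]. *)
Lemma harmonic_le_powR (R : realType) (r : R) (n : nat) : 0 < r -> (0 < n)%N ->
  harmonic_sum R (2 * n) <= (2 + r^-1) * n%:R `^ r.
Proof.
move=> r0 n0; have nR : 1 <= n%:R :> R by rewrite ler1n.
have n_gt0 : 0 < n%:R :> R by rewrite ltr0n.
have -> : (2 * n)%N = (2 * n).-1.+1 by rewrite prednK // muln_gt0.
apply: le_trans (harmonic_le_ln _ _) _; rewrite prednK ?muln_gt0 //.
rewrite natrM lnM ?posrE //.
have ln2 : ln 2 <= 1 :> R by have := @le_ln1Dx R 1; rewrite -[1 + 1]/(2%:R); apply; lra.
have y1 : 1 <= n%:R `^ r :> R by have := ler_powR nR (ltW r0); rewrite powRr0.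
have lnn : ln n%:R <= r^-1 * n%:R `^ r :> R.
  rewrite mulrC ler_pdivlMr // mulrC -ln_powR.
  by apply/ltW/ln_sublinear/powR_gt0.
by rewrite mulrDl; lra.
Qed.

Lemma count_roots_le (R : idomainType) (phi : {poly R}) (d : nat) (A : seq R) (y : R) :
  size phi = d.+2 -> uniq A -> (count (fun a => phi.[a] == y) A <= d.+1)%N.
Proof.
move=> phi_size A_uniq; rewrite -size_filter -ltnS -phi_size.
have sizeE : size (phi - y%:P) = size phi.
  by rewrite size_polyDl // size_polyN phi_size (leq_ltn_trans (size_polyC_leq1 _)).
rewrite -sizeE; apply: max_poly_roots; last exact: filter_uniq.
  by rewrite -size_poly_gt0 sizeE phi_size.
by apply/allP => a; rewrite mem_filter => /andP[/eqP aE _]; rewrite rootE !hornerE aE subrr.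
Qed.

Lemma sorted_enum (R : realDomainType) (B : {fset R}) n : #|` B| = n ->
  exists2 b : 'I_n -> R, {homo b : i j / (i < j)%N >-> i < j} & forall i, b i \in B.
Proof.
move=> Bn; pose s := sort <=%R (enum_fset B).
have s_size : size s = n by rewrite size_sort.
exists (fun i => s`_i) => [i j ij|i]; last by rewrite -(mem_sort <=%R) mem_nth // s_size.
rewrite (sorted_ltn_nth lt_trans) ?inE ?s_size //.
by rewrite sort_lt_sorted fset_uniq.
Qed.

Theorem theorem2 (R : realType) (d : nat) (eps : R) :
  (3 <= d)%N -> 0 < eps ->
  exists2 c : R, 0 < c &
    forall (phi : {poly R}) (n : nat) (A B C : {fset R}),
      size phi = d.+1 -> (0 < n)%N ->
      #|` A| = n -> #|` B| = n -> #|` C| = n ->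
      c * powR (n%:R) (5 / 3 - eps) <= #|` image3 (sqdist_poly phi) A B C|%:R.
Proof.
move=> d3 eps0.
case: d d3 => // d _.
(* the square of [n `^ r] makes up for the cube of [n `^ (- eps)] *)
pose r := 3 / 2 * eps; pose M := 2 + r^-1.
have r0 : 0 < r by rewrite mulr_gt0 // divr_gt0.
have M0 : 0 < M by rewrite addr_gt0 // invr_gt0.
pose K : R := (288 * d.+2%:R) ^+ 2 * 128 ^+ 3 * M ^+ 2.
have K0 : 0 <= K by rewrite mulr_ge0 ?sqr_ge0 // mulr_ge0 ?sqr_ge0 ?exprn_ge0.
exists (1 + K)^-1; first by rewrite invr_gt0 ltr_pwDl.
move=> phi n A B C phi_size n0 An Bn Cn.
have [b b_incr bB] := sorted_enum Bn.
have [c c_incr cC] := sorted_enum Cn.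
set V := image3 _ _ _ _; set y := n%:R `^ _.
have H1 := harmonic_ge1 R n0.
have := @expansion R n d.+1 (enum_fset A) (enum_fset V) (fun a => phi.[a]) b c
  n0 (fset_uniq A) An b_incr c_incr (fun y => count_roots_le y phi_size (fset_uniq A)).
have inV a z : a \in enum_fset A -> sqdist b c a phi.[a] z \in enum_fset V.
  by move=> aA; apply/image3P; exists a, (b z.1), (c z.2); split.
move=> /(_ inV); set N : R := #|` V|%:R; set H := harmonic_sum _ _ => main.
have HM := harmonic_le_powR r0 n0.
have n_neq0 : n%:R != 0 :> R by rewrite pnatr_eq0 -lt0n.
have y0 : 0 < y by rewrite powR_gt0 // ltr0n.
set w := n%:R `^ r in HM.
have w0 : 0 < w by rewrite powR_gt0 // ltr0n.
have yw : n%:R ^+ 5 = y ^+ 3 * w ^+ 2.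
  rewrite -!powR_mulrn ?powR_ge0 ?ler0n // -!powRrM -powRD ?n_neq0 ?implybT //.
  by congr (_ `^ _); rewrite /r; field.
have N0 : 0 <= N by rewrite ler0n.
have yN : y ^+ 3 <= K * N ^+ 3.
  have w20 : 0 < w ^+ 2 by rewrite exprn_gt0.
  rewrite -(ler_pM2r w20) -yw; apply: le_trans main _.
  have -> : K * N ^+ 3 * w ^+ 2 = (288 * d.+2%:R) ^+ 2 * (128 * N) ^+ 3 * (M * w) ^+ 2.
    by rewrite /K; ring.
  apply: ler_wpM2l; first by rewrite mulr_ge0 ?sqr_ge0 ?exprn_ge0 ?mulr_ge0.
  by apply: lerXn2r HM; rewrite nnegrE ?mulr_ge0 ?(ltW M0) ?(ltW w0) ?(le_trans ler01).
have K1 : 0 < 1 + K by rewrite ltr_pwDl.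
rewrite mulrC ler_pdivrMr //.
rewrite -(@ler_pXn2r _ 3) ?nnegrE ?(ltW y0) ?mulr_ge0 ?(ltW K1) //.
apply: (le_trans yN); rewrite exprMn mulrC ler_wpM2l ?exprn_ge0 //.
have : 1 + K <= (1 + K) ^+ 3 by rewrite -[leLHS]expr1 ler_weXn2l // lerDl.
by lra.
Qed.
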